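(* Let $F:\mathbb{R}^d\to\mathbb{R}^d$ be the deterministic generation map $\mathbf{x}_0=F(\mathbf{x}_T)$ of a diffusion model, sending initial noise to a generated image, where $F$ is invertible with inverse $F^{-1}$ and both $F$ and $F^{-1}$ are Borel measurable. Let $\mathbb{Q}_c$ and $\mathbb{Q}_s$ be Borel probability distributions on $\mathbb{R}^d$: respectively the distribution of the normal diffusion model noise and the distribution of noise containing secret messages. Let $\mathbb{P}_c=F_{\#}\mathbb{Q}_c$ be the distribution of normally generated images and $\mathbb{P}_s=F_{\#}\mathbb{Q}_s$ the distribution of stego images. Then $$D_{KL}(\mathbb{P}_c\,\|\,\mathbb{P}_s)=D_{KL}(\mathbb{Q}_c\,\|\,\mathbb{Q}_s).$$
   Context: For a Borel probability measure $\mathbb{Q}$ on $\mathbb{R}^d$, $F_{\#}\mathbb{Q}$ denotes the pushforward measure $F_{\#}\mathbb{Q}(A)=\mathbb{Q}(F^{-1}(A))$, i.e. the law of $F(\mathbf{g})$ when $\mathbf{g}\sim\mathbb{Q}$. The Kullback-Leibler divergence of probability measures $\mathbb{P},\mathbb{P}'$ is $D_{KL}(\mathbb{P}\|\mathbb{P}')=\int \log\frac{d\mathbb{P}}{d\mathbb{P}'}\,d\mathbb{P}\in[0,+\infty]$ if $\mathbb{P}\ll\mathbb{P}'$, and $+\infty$ otherwise (in the discrete case, $\sum_{\mathbf{x}}\mathbb{P}(\mathbf{x})\log\frac{\mathbb{P}(\mathbf{x})}{\mathbb{P}'(\mathbf{x})}$). Origin of $F$: in a diffusion model, $F$ is the solution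 map from time $T$ to time $0$ of the probability flow ODE $\mathrm{d}\mathbf{x}=\left[f(\mathbf{x},t)-\tfrac12 g(t)^2\nabla_{\mathbf{x}}\log\mathbb{P}_t(\mathbf{x})\right]\mathrm{d}t$, where $f$ and $g$ are the drift and diffusion coefficients and $\mathbb{P}_t$ is the marginal density at time $t$. This map is taken to be deterministic and invertible, and $F^{-1}$ is the corresponding reverse process. Images, both normal and stego, are obtained by applying the same $F$ to a noise vector. Only the invertibility of $F$ (with measurability both ways) and the pushforward relations are assumed about $F$ and the distributions. *)

(* Defs.v *)
From mathcomp Require Import all_boot all_order all_algebra.
From mathcomp Require Import all_classical all_reals all_analysis.

Set Implicit Arguments.
Unset Strict Implicit.
Unset Printing Implicit Defensive.

Import Order.TTheory GRing.Theory Num.Theory.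
Import numFieldNormedType.Exports.

Local Open Scope classical_set_scope.
Local Open Scope ring_scope.
Local Open Scope ereal_scope.
Local Open Scope charge_scope.

(* The topology of 'rV[R]_d is that of the sup norm, i.e. the Euclidean one. *)
Definition borel_rV (R : realType) (d : nat) :
    measurableType (@open 'rV[R]_d).-sigma :=
  g_sigma_algebraType (@open 'rV[R]_d).

(* [Radon_Nikodym] selects one version of the density dP/dQ, determined up to
   a Q-null set. That set is P-null when P << Q, and so is the set where the
   density is <= 0 and [lne] takes the value -oo; neither affects the integral.
   The integral is \int log^+ - \int log^-, whose second term is finite. *)
Definition KL_divergence (disp : measure_display) (T : measurableType disp)
    (R : realType) (P Q : probability T R) : \bar R :=
  if `[< P `<< Q >] then
    \int[P]_x lne ('d (charge_of_finite_measure P) '/d Q x)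
  else +oo.

(* Main.v *)
(* With g the density of P_c with respect to P_s, the change of variables
   formula shows that g o F integrates against Q_s to P_c(F(E)) = Q_c(E) over
   every measurable E = F^-1(F(E)), so g o F is a density of Q_c with respect to
   Q_s; densities are a.e. unique, and another change of variables transports
   the integral of the logarithm. *)
Require Import Defs.
From mathcomp Require Import all_boot all_order all_algebra.
From mathcomp Require Import all_classical all_reals all_analysis.
From mathcomp Require Import measurable_realfun.

Set Implicit Arguments.
Unset Strict Implicit.
Unset Printing Implicit Defensive.

Local Open Scope classical_set_scope.
Local Open Scope ring_scope.
Local Open Scope ereal_scope.
Local Open Scope charge_scope.

Lemma measurable_lne (R : realType) : measurable_fun [set: \bar R] (@lne R).
Proof.
(* The case split is needed because [er_map ln] differs from [lne] at finite nonpositive arguments;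
   at both infinities the two agree. *)
rewrite (_ : @lne R = fun x => if x <= 0 then -oo else er_map (@ln R) x).
  apply: measurable_fun_ifT => //.
  - exact: measurable_fun_lee.
  - exact: measurable_er_map R _ _ (@measurable_ln R).
by apply/funext => -[r| |] /=; rewrite ?lee_fin ?leNye.
Qed.

(* Unlike [integral_pushforward], this requires no integrability: the divergence
   may be infinite. *)
Lemma integral_pushforwardT d1 d2 (X : measurableType d1)
    (Y : measurableType d2) (R : realType) (phi : X -> Y)
    (mu : {measure set X -> \bar R}) (f : Y -> \bar R) :
  measurable_fun [set: X] phi -> measurable_fun [set: Y] f ->
  \int[pushforward mu phi]_y f y = \int[mu]_x (f \o phi) x.
Proof.
(* The positive and negative parts are transported separately: change of variables for nonnegative
   functions allows infinite values. *)
move=> mphi mf; rewrite [LHS]integralE [RHS]integralE (funepos_comp f phi)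
  (funeneg_comp f phi).
congr (_ - _); rewrite (ge0_integral_pushforward mphi) ?preimage_setT//.
- exact: measurable_funepos.
- exact: measurable_funeneg.
Qed.

Section measurable_left_inverse.
Context d d' (T : measurableType d) (T' : measurableType d') (R : realType).
Variables (F : {mfun T >-> T'}) (G : {mfun T' >-> T}).
Hypothesis FK : cancel F G.

(** The preimage under [G] stands in for the image F(A): it is measurable, and pulling it back along
    [F] recovers exactly A. *)
Let preimageK (A : set T) : F @^-1` (G @^-1` A) = A.
Proof. by apply/seteqP; split => x /=; rewrite FK. Qed.

Let measurableG (A : set T) : measurable A -> measurable (G @^-1` A).
Proof.
by move=> mA; rewrite -[X in measurable X]setTI; exact: measurable_funP.
Qed.

Variables P Q : probability T R.

Lemma null_dominates_distribution :
  (distribution P F `<< distribution Q F) <-> (P `<< Q).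
Proof.
split; last first.
  exact: (@dominates_pushforward _ _ _ _ _ Q (charge_of_finite_measure P)).
move=> /null_content_dominatesP PQ; apply/null_content_dominatesP => A mA QA.
(* The [Q]-mass of A is the pushforward mass of its preimage under [G], and likewise for [P]. *)
by move: QA; rewrite -(preimageK A); exact: PQ (measurableG mA).
Qed.

Lemma ae_eq_Radon_Nikodym_distribution : P `<< Q ->
  ae_eq Q [set: T]
    ('d (charge_of_finite_measure P) '/d Q)
    ('d (charge_of_finite_measure (distribution P F)) '/d (distribution Q F)
       \o F).
Proof.
move=> PQ; have PQF := null_dominates_distribution.2 PQ.
set g := 'd _ '/d (distribution Q F).
have ig : (distribution Q F).-integrable setT g.
  exact: Radon_Nikodym_integrable.
have mg : measurable_fun setT g := measurable_int _ ig.
have mgF : measurable_fun setT (g \o F) by exact: measurableT_comp.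
have igF : Q.-integrable setT (g \o F).
  apply/integrableP; split => //.
  have /integrableP[_] := ig; rewrite ge0_integral_pushforward//.
  exact: measurableT_comp.
(* Integrable functions with equal integrals over every measurable E agree [Q]-a.e. *)
apply: integral_ae_eq => //; first exact: Radon_Nikodym_integrable.
move=> E _ mE; rewrite -Radon_Nikodym_integral//.
rewrite -[in RHS](preimageK E) -integral_pushforward//; last 2 first.
- by rewrite preimageK; exact: integrableS igF.
- exact: measurableG.
rewrite -[RHS]Radon_Nikodym_integral//; last exact: measurableG.
by rewrite /charge_of_finite_measure /= /distribution /pushforward preimageK.
Qed.

Lemma KL_divergence_distribution :
  KL_divergence (distribution P F) (distribution Q F) = KL_divergence P Q.
Proof.
rewrite /KL_divergence (asbool_equiv_eq null_dominates_distribution).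
case: asboolP => // PQ; have PQF := null_dominates_distribution.2 PQ.
set g := 'd _ '/d (distribution Q F).
have mg : measurable_fun setT g.
  by apply: measurable_int; exact: Radon_Nikodym_integrable.
have mlg : measurable_fun setT (@lne R \o g).
  exact: measurableT_comp (@measurable_lne R) mg.
rewrite (integral_pushforwardT P _ mlg)//.
apply: ae_eq_integral => //.
- exact: measurableT_comp.
- apply: measurableT_comp; first exact: measurable_lne.
  by apply: measurable_int; exact: Radon_Nikodym_integrable.
(* The densities agree only [Q]-a.e.; [PQ] turns this into [P]-a.e., as integration against [P]
   requires. *)
- apply: ae_eq_sym; apply: (ae_eq_comp (@lne R)).
  apply: (null_dominates_ae_eq _ PQ) => //.
  exact: ae_eq_Radon_Nikodym_distribution.
Qed.

End measurable_left_inverse.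

Theorem theorem1 (R : realType) (d : nat)
    (F Finv : {mfun borel_rV R d >-> borel_rV R d})
    (FK : cancel F Finv) (FinvK : cancel Finv F)
    (Qc Qs : probability (borel_rV R d) R) :
  KL_divergence (distribution Qc F) (distribution Qs F) = KL_divergence Qc Qs.
Proof. exact: KL_divergence_distribution FK Qc Qs. Qed.
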